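(* The standard parabolic faces $F_I$, $I\subseteq\{1,\dots,n\}$, form a complete set of representatives of the $W$-orbits of the faces of $\mathcal P_\Phi$ (every nonempty face of $\mathcal P_\Phi$ is mapped by some element of $W$ to some $F_I$, and two distinct standard parabolic faces are never in the same $W$-orbit). Moreover, the $f$-polynomial of $\mathcal P_\Phi$ is $$\sum_{I\in\mathcal I}[W:W\langle\Pi\setminus\Pi_{\partial I}\rangle]\,t^{\,n-|I|},$$ where $\mathcal I=\{I\subseteq\{1,\dots,n\}\mid\widehat\Phi(\widehat\Pi\setminus\Pi_I)\text{ is irreducible}\}$.
   Context: $\Phi$ is a finite irreducible reduced crystallographic root system of rank $n$ in the Euclidean space $\mathrm{Span}_{\mathbb R}\Phi$ with scalar product $(\cdot,\cdot)$; $\Pi=\{\alpha_1,\dots,\alpha_n\}$ is a root basis, $W$ the Weyl group, $\theta=\sum_{i=1}^n m_i\alpha_i$ the highest root, and $\breve\omega_1,\dots,\breve\omega_n$ the basis dual to $\Pi$, i.e. $(\breve\omega_i,\alpha_j)=\delta_{ij}$. $\mathcal P_\Phi$ is the convex hull of $\Phi$. For $I\subseteq\{1,\dots,n\}$: $\Pi_I=\{\alpha_i\mid i\in I\}$, $F_I=\{x\in\mathcal P_\Phi\mid(x,\breve\omega_i)=m_i\ \forall i\in I\}$ (so $F_\emptyset=\mathcal P_\Phi$). For $\Gamma\subseteq\Phi$, $W\langle\Gamma\rangle$ is the subgroup of $W$ generated by the reflections $s_\alpha$, $\alpha\in\Gamma$. Affine root system: in $\mathrm{Span}_{\mathbb R}\Phi\oplus\mathbb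 R\delta$, with the scalar product extended so that $\mathbb R\delta$ is the kernel, $\widehat\Phi=\{\alpha+k\delta\mid\alpha\in\Phi,k\in\mathbb Z\}$, $\alpha_0=-\theta+\delta$, $\widehat\Pi=\Pi\cup\{\alpha_0\}$. For $\Gamma\subseteq\widehat\Pi$, $\widehat\Phi(\Gamma)$ is the standard parabolic root subsystem of $\widehat\Phi$ generated by $\Gamma$; it is irreducible iff $\Gamma$ is connected in the extended Dynkin diagram. $(\widehat\Pi\setminus\Pi_I)_0$ denotes the set of simple roots in the connected component of $\alpha_0$ in the subdiagram of the extended Dynkin diagram induced by $\widehat\Pi\setminus\Pi_I$, and $\partial I=\{j\in I\mid\exists\,\beta\in(\widehat\Pi\setminus\Pi_I)_0\text{ with }(\beta,\alpha_j)\neq0\}$. Faces are nonempty, and $\mathcal P_\Phi$ is counted as a face of itself; the $f$-polynomial is $\sum_{k=0}^n f_kt^k$, where $f_k$ is the number of $k$-dimensional faces of $\mathcal P_\Phi$ (so $f_n=1$). *)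

(* Defs.v *)
From HB Require Import structures.
From mathcomp Require Import all_boot all_order all_algebra.
From mathcomp Require Import finmap sesquilinear.
From mathcomp Require Import boolp classical_sets functions cardinality reals.

Set Implicit Arguments.
Unset Strict Implicit.
Unset Printing Implicit Defensive.

Import Order.TTheory GRing.Theory Num.Theory.
Local Open Scope classical_set_scope.
Local Open Scope ring_scope.

(* Number of elements of a finite set (0 on infinite sets). *)
Definition ncard (T : choiceType) (A : set T) : nat := #|` fset_set A|%fset.

(* A set of (real, possibly affine) roots is irreducible if it is nonempty and
   is not the union of two nonempty mutually orthogonal subsets. *)
Definition irreducible_roots (R : realType) (T : Type) (form : T -> T -> R)
    (Psi : set T) : Prop :=
  Psi !=set0 /\
  ~ exists A B : set T,
      [/\ A !=set0, B !=set0, A `|` B = Psi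
        & forall a b, A a -> B b -> form a b = 0].

Section Euclidean.
Variables (R : realType) (V : vectType R) (dot : {dot V for idfun}).

Definition refl (a x : V) : V := x - (2 * dot x a / dot a a) *: a.

Record is_root_system (Phi : {fset V}) : Prop := IsRootSystem {
  rs_span : <<Phi>>%VS = fullv;
  rs_nonzero : 0 \notin Phi;
  rs_refl : forall a b, a \in Phi -> b \in Phi -> refl a b \in Phi;
  rs_cryst : forall a b, a \in Phi -> b \in Phi ->
    2 * dot b a / dot a a \is a Num.int;
  rs_reduced : forall a (c : R), a \in Phi -> c *: a \in Phi ->
    c = 1 \/ c = - 1
}.

Record is_root_basis (Phi : {fset V}) (n : nat) (alpha : 'I_n -> V) : Prop :=
  IsRootBasis {
  rb_root : forall i, alpha i \in Phi;
  rb_basis : basis_of fullv [tuple alpha i | i < n];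
  rb_sign : forall b, b \in Phi -> exists k : 'I_n -> int,
    b = \sum_i alpha i *~ k i /\
    ((forall i, 0 <= k i) \/ (forall i, k i <= 0))
}.

Definition is_highest_root (Phi : {fset V}) (n : nat) (alpha : 'I_n -> V)
    (theta : V) : Prop :=
  theta \in Phi /\
  forall b, b \in Phi -> exists k : 'I_n -> nat,
    theta - b = \sum_i alpha i *+ k i.

(* The group generated by the reflections in the vectors of G; products
   suffice because reflections are involutions. *)
Inductive refl_group (G : set V) : (V -> V) -> Prop :=
| refl_group1 : refl_group G idfun
| refl_groupM a w : G a -> refl_group G w -> refl_group G (refl a \o w).

(* [G : H], as the number of left cosets g H. *)
Definition group_index (G H : set (V -> V)) : nat :=
  ncard [set [set g \o h | h in H] | g in G].

Definition root_polytope (Phi : {fset V}) : set V :=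
  [set x | exists c : V -> R,
     [/\ forall a, a \in Phi -> 0 <= c a,
         \sum_(a <- Phi) c a = 1
       & x = \sum_(a <- Phi) c a *: a]].

(* Nonempty faces; v = 0, c = 0 gives P itself. *)
Definition is_face (P F : set V) : Prop :=
  F !=set0 /\
  exists (v : V) (c : R),
    (forall x, P x -> dot x v <= c) /\ F = P `&` [set x | dot x v = c].

(* A is nonempty and its affine hull, whose direction is the smallest subspace
   U containing all differences of points of A, has dimension k. *)
Definition has_aff_dim (A : set V) (k : nat) : Prop :=
  A !=set0 /\
  exists U : {vspace V},
    [/\ \dim U = k,
        forall x y, A x -> A y -> x - y \in U
      & forall U' : {vspace V},
          (forall x y, A x -> A y -> x - y \in U') -> (U <= U')%VS].

Definition face_number (P : set V) (k : nat) : nat :=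
  ncard [set F | is_face P F /\ has_aff_dim F k].

Section Standard.
Variables (Phi : {fset V}) (n : nat).
Variables (alpha omega : 'I_n -> V) (theta : V) (m : 'I_n -> nat).

Definition std_face (I : {set 'I_n}) : set V :=
  [set x | root_polytope Phi x /\ forall i, i \in I -> dot x (omega i) = (m i)%:R].

(* V * R^o is V (+) R delta, with delta = (0, 1). *)
Definition aff_dot (x y : V * R^o) : R := dot x.1 y.1.

Definition aff_roots : set (V * R^o) :=
  [set x | x.1 \in Phi /\ x.2 \is a Num.int].

(* The extended simple roots, indexed by option 'I_n with None for alpha_0. *)
Definition aff_simple (o : option 'I_n) : V * R^o :=
  if o is Some i then (alpha i, 0) else (- theta, 1).

Definition aff_parabolic (Gamma : {set option 'I_n}) : set (V * R^o) :=
  aff_roots `&`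
  [set x | x \in <<[seq aff_simple o | o <- enum Gamma]>>%VS].

(* The index set of the simple roots outside Pi_I (alpha_0 included). *)
Definition aff_compl (I : {set 'I_n}) : {set option 'I_n} :=
  ~: (Some @: I)%SET.

Definition ext_dynkin (Gamma : {set option 'I_n}) : rel (option 'I_n) :=
  fun o p => [&& o \in Gamma, p \in Gamma, o != p
               & aff_dot (aff_simple o) (aff_simple p) != 0].

Definition comp0 (I : {set 'I_n}) : pred (option 'I_n) :=
  connect (ext_dynkin (aff_compl I)) None.

Definition border (I : {set 'I_n}) : {set 'I_n} :=
  finset (fun j => (j \in I) &&
    [exists o, comp0 I o && (aff_dot (aff_simple o) (aff_simple (Some j)) != 0)]).

End Standard.
End Euclidean.

(* Main.v *)
Require Import Defs.
From HB Require Import structures.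
From mathcomp Require Import all_boot all_order all_algebra.
From mathcomp Require Import finmap sesquilinear.
From mathcomp Require Import boolp classical_sets functions cardinality reals.
From mathcomp Require Import ring lra.

Set Implicit Arguments.
Unset Strict Implicit.
Unset Printing Implicit Defensive.

Import Order.TTheory GRing.Theory Num.Theory.
Local Open Scope classical_set_scope.
Local Open Scope ring_scope.

(* A face exposed by a functional [v] can be moved by W so that [v] is dominant;
   since [theta] dominates every root coordinatewise, it then is [F_I] for
   [I = {i | (v, alpha_i) > 0}]. Let [b_I] be the sum of the roots lying on [F_I].
   It is dominant and determines the face, so by Chevalley's theorem on dominant
   vectors two [F_I] in one orbit coincide, and the stabilizer of [F_I] is generated
   by the simple reflections fixing [b_I], which are those outside the border of [I].

   Different [I] may give the same face: a root [b] on [F_I] can satisfy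
   [(b, omega_i) < m_i] exactly when [alpha_i] lies in the component of [alpha_0]
   after removal of [I]. The largest index set of [F_I] is therefore the complement of
   that component. It equals [I] iff the affine parabolic subsystem is irreducible,
   and then the differences of points of [F_I] span the [alpha_i] with [i \notin I],
   so that [F_I] has dimension [n - #|I|]. *)

(** * Reflections and the groups they generate *)

Section Reflections.
Variables (R : realType) (V : vectType R) (dot : {dot V for idfun}).

Lemma dotC x y : dot x y = dot y x.
Proof. by rewrite hermC expr0 mul1r. Qed.

Lemma dotDl x y z : dot (x + y) z = dot x z + dot y z.
Proof. exact: linearDl. Qed.

Lemma dotBl x y z : dot (x - y) z = dot x z - dot y z.
Proof. exact: linearBl. Qed.

Lemma dotNl x z : dot (- x) z = - dot x z.
Proof. exact: linearNl. Qed.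

Lemma dotZl c x z : dot (c *: x) z = c * dot x z.
Proof. exact: linearZl_LR. Qed.

Lemma dotBr z x y : dot z (x - y) = dot z x - dot z y.
Proof. exact: linearBr. Qed.

Lemma dotNr z x : dot z (- x) = - dot z x.
Proof. exact: linearNr. Qed.

Lemma dotZr c z x : dot z (c *: x) = c * dot z x.
Proof. by rewrite dotC dotZl dotC. Qed.

Lemma dot0l z : dot 0 z = 0.
Proof. exact: linear0l. Qed.

Lemma dot_suml I (r : seq I) (P : pred I) (F : I -> V) z :
  dot (\sum_(i <- r | P i) F i) z = \sum_(i <- r | P i) dot (F i) z.
Proof. exact: linear_sumlz. Qed.

Lemma dot_sumr I (r : seq I) (P : pred I) (F : I -> V) z :
  dot z (\sum_(i <- r | P i) F i) = \sum_(i <- r | P i) dot z (F i).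
Proof. exact: linear_sumr. Qed.

Lemma dot_gt0 x : x != 0 -> 0 < dot x x.
Proof. exact: neq0_dnorm_gt0. Qed.

Lemma dot_eq0 x : (dot x x == 0) = (x == 0).
Proof.
have [->|x0] := eqVneq x 0; first by rewrite dot0l eqxx.
by rewrite gt_eqF // dot_gt0.
Qed.

Local Notation refl := (refl dot).
Local Notation W := (refl_group dot).

Lemma dot_refll a x y : dot (refl a x) y = dot x y - 2 * dot x a / dot a a * dot a y.
Proof. by rewrite /Defs.refl dotBl dotZl. Qed.

Lemma refl_self a : refl a a = - a.
Proof.
rewrite /Defs.refl; have [->|a0] := eqVneq a 0; first by rewrite scaler0 subr0 oppr0.
have aa : dot a a != 0 by rewrite dot_eq0.
by rewrite mulfK // scaler_nat opprD addrA subrr sub0r.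
Qed.

Lemma refl_isom a x y : dot (refl a x) (refl a y) = dot x y.
Proof.
rewrite /Defs.refl; have [->|a0] := eqVneq a 0; first by rewrite !scaler0 !subr0.
have aa : dot a a != 0 by rewrite dot_eq0.
rewrite !(dotBl, dotBr, dotZl, dotZr) (dotC a y).
by field.
Qed.

Lemma reflD a x y : refl a (x + y) = refl a x + refl a y.
Proof. by rewrite /Defs.refl dotDl mulrDr mulrDl scalerDl opprD addrACA. Qed.

Lemma reflZ a c x : refl a (c *: x) = c *: refl a x.
Proof.
by rewrite /Defs.refl dotZl scalerBr scalerA; congr (_ - _ *: _); ring.
Qed.

Lemma reflK a : involutive (refl a).
Proof.
move=> x; rewrite {1}/Defs.refl dot_refll /Defs.refl.
have [->|a0] := eqVneq a 0; first by rewrite !scaler0 !subr0.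
have aa : dot a a != 0 by rewrite dot_eq0.
by rewrite -addrA -opprD -scalerDl -[RHS]subr0; congr (_ - _);
   rewrite -[RHS](scale0r a); congr (_ *: _); field.
Qed.

Lemma refl_dotC a x y : dot (refl a x) y = dot x (refl a y).
Proof. by rewrite -{2}(reflK a x) refl_isom. Qed.

Lemma refl_id a x : dot x a = 0 -> refl a x = x.
Proof. by rewrite /Defs.refl => ->; rewrite mulr0 mul0r scale0r subr0. Qed.

Lemma reflN a : refl (- a) = refl a.
Proof.
apply/funext => x; rewrite /Defs.refl !(dotNl, dotNr) opprK scalerN -scaleNr.
by congr (_ - _ *: _); rewrite mulrN !mulNr opprK.
Qed.

Lemma refl_conj b a x : refl (refl b a) x = refl b (refl a (refl b x)).
Proof.
rewrite {1}/Defs.refl refl_isom -refl_dotC [refl a _]/Defs.refl -[in RHS]scaleNr reflD.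
by rewrite reflZ reflK scaleNr.
Qed.

Section Group.
Variable G : set V.

Lemma refl_group_isom w : W G w -> forall x y, dot (w x) (w y) = dot x y.
Proof. by elim=> [|a {}w Ga _ IH] x y //=; rewrite refl_isom IH. Qed.

Lemma refl_groupD w : W G w -> {morph w : x y / x + y}.
Proof. by elim=> [|a {}w Ga _ IH] x y //=; rewrite IH reflD. Qed.

Lemma refl_group0 w : W G w -> w 0 = 0.
Proof.
by move=> /refl_groupD wD; apply: (addrI (w 0)); rewrite -wD !addr0.
Qed.

Lemma refl_groupZ w : W G w -> forall c x, w (c *: x) = c *: w x.
Proof. by elim=> [|a {}w Ga _ IH] c x //=; rewrite IH reflZ. Qed.

Lemma refl_groupN w : W G w -> {morph w : x / - x}.
Proof. by move=> Gw x; rewrite -scaleN1r (refl_groupZ Gw) scaleN1r. Qed.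

Lemma refl_groupB w : W G w -> {morph w : x y / x - y}.
Proof. by move=> Gw x y; rewrite (refl_groupD Gw) (refl_groupN Gw). Qed.

Lemma refl_group_sum w : W G w -> forall I (r : seq I) (F : I -> V),
  w (\sum_(i <- r) F i) = \sum_(i <- r) w (F i).
Proof.
by move=> Gw I r F; elim/big_rec2: _ => [|i x y _ <-];
   rewrite ?(refl_group0 Gw) ?(refl_groupD Gw).
Qed.

Lemma refl_group_comp w w' : W G w -> W G w' -> W G (w \o w').
Proof. by elim=> [|a {}w Ga _ IH] // Gw'; apply: (refl_groupM Ga); apply: IH. Qed.

Lemma refl_group_refl a : G a -> W G (refl a).
Proof. by move=> Ga; apply: (refl_groupM (w := idfun)) => //; exact: refl_group1. Qed.

Lemma refl_group_inv w : W G w -> exists w', [/\ W G w', cancel w w' & cancel w' w].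
Proof.
elim=> [|a {}w Ga _ [w' [Gw' ww' w'w]]]; first by exists idfun; split; [exact: refl_group1| |].
exists (w' \o refl a); split; first exact: refl_group_comp (refl_group_refl Ga).
  by move=> x /=; rewrite reflK.
by move=> x /=; rewrite w'w reflK.
Qed.

Lemma refl_group_sub (G' : set V) w : G `<=` G' -> W G w -> W G' w.
Proof.
move=> GG'; elim=> [|a {}w Ga _ IH]; first exact: refl_group1.
by apply: refl_groupM => //; apply: GG'.
Qed.

End Group.

End Reflections.

(** * Affine dimension and counting *)

Section AffineDimension.
Variables (R : realType) (V : vectType R) (dot : {dot V for idfun}).

Lemma has_aff_dim_inj (A : set V) k k' : has_aff_dim A k -> has_aff_dim A k' -> k = k'.
Proof.
move=> [_ [U [<- UA Umin]]] [_ [U' [<- UA' Umin']]].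
by congr (\dim _); apply: subv_anti; rewrite Umin // Umin'.
Qed.

(** Elements of the group are linear bijections, so the direction of the image is the image of the
    direction; minimality is pulled back along the inverse [w']. *)
Lemma has_aff_dim_weyl (G : set V) w A k : refl_group dot G w ->
  has_aff_dim A k -> has_aff_dim (w @` A) k.
Proof.
move=> Gw [[a Aa] [U [Uk UA Umin]]]; split; first by exists (w a), a.
have [w' [Gw' ww' w'w]] := refl_group_inv Gw.
have lin u (Gu : refl_group dot G u) : linear u.
  by move=> c x y; rewrite (refl_groupD Gu) (refl_groupZ Gu).
pose f (u : V -> V) Gu : {linear V -> V} :=
  HB.pack u (GRing.isLinear.Build R V V *:%R u (lin u Gu)).
have fE u Gu x : linfun (f u Gu) x = u x by rewrite lfunE.
exists (linfun (f w Gw) @: U)%VS; split.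
- rewrite limg_dim_eq //; suff /eqP -> : lker (linfun (f w Gw)) == 0%VS by rewrite capv0.
  by apply/lker0P => x y; rewrite !fE; exact: can_inj ww' _ _.
- move=> _ _ [x Ax <-] [y Ay <-]; rewrite -(refl_groupB Gw) -(fE w Gw).
  by rewrite memv_img // UA.
move=> U' UA'; apply/subvP => _ /memv_imgP[x xU ->]; rewrite fE.
have : (U <= linfun (f w' Gw') @: U')%VS.
  apply: Umin => y z Ay Az; have -> : y - z = linfun (f w' Gw') (w y - w z).
    by rewrite fE (refl_groupB Gw') !ww'.
  by apply: memv_img; apply: UA'; [exists y|exists z].
by move=> /subvP/(_ x xU)/memv_imgP[y yU ->]; rewrite fE w'w.
Qed.

End AffineDimension.

Section Counting.

(** Serves to count an orbit by cosets. A section [h] of [f] turns [g \o h] into a bijection between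
    the two images. *)
Lemma ncard_image_eq (T : Type) (X Y : choiceType) (D : set T) (f : T -> X) (g : T -> Y) :
  finite_set (f @` D) ->
  (forall x y, D x -> D y -> f x = f y <-> g x = g y) ->
  ncard (f @` D) = ncard (g @` D).
Proof.
move=> fin fg; have [->|/set0P[t0 Dt0]] := eqVneq D set0.
  by rewrite !image_set0 /ncard !fset_set0 !cardfs0.
have [h hP] : {h : X -> T & forall y, (f @` D) y -> D (h y) /\ f (h y) = y}.
  apply: (@choice _ _ (fun y t => (f @` D) y -> D t /\ f t = y)) => y.
  by have [[t Dt ty]|n] := pselect ((f @` D) y); [exists t|exists t0].
have hf t : D t -> g (h (f t)) = g t.
  move=> Dt; have fDt : (f @` D) (f t) by exists t.
  by have [Dh e] := hP _ fDt; apply/fg.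
have -> : g @` D = (g \o h) @` (f @` D).
  by rewrite image_comp; apply: eq_imagel => t Dt /=; rewrite hf.
rewrite /ncard fset_set_image // card_in_imfset //= => x y.
rewrite !in_fset_set // !inE => -[t Dt <-] [s Ds <-]; rewrite !hf //.
by move=> gts; apply/fg.
Qed.

(** Double counting: each part is counted by its indicator over [S], and after exchanging the sums
    every element of [S] contributes exactly one index. *)
Lemma ncard_partition (T : choiceType) (J : finType) (Q : pred J) (S : set T) (O : J -> set T) :
  finite_set S -> (forall x, S x <-> exists2 j, Q j & O j x) ->
  (forall i j x, Q i -> Q j -> O i x -> O j x -> i = j) ->
  ncard S = (\sum_(j | Q j) ncard (O j))%N.
Proof.
move=> fin SO disj.
have cardO j : Q j -> ncard (O j) = (\sum_(x <- fset_set S) `[< O j x >])%N.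
  move=> Qj; have OE : O j = [set` [fset x in fset_set S | `[< O j x >]]%fset].
    apply/seteqP; split=> x /=; rewrite !inE in_fset_set // ?inE.
      by move=> Ox; rewrite asboolT // andbT inE; apply/SO; exists j.
    by move=> /andP[_ /asboolP].
  rewrite [in LHS]OE /ncard set_fsetK card_fset_sum1 -big_fset_condE big_mkcond /=.
  by apply: eq_bigr => x _; case: `[< _ >].
rewrite (eq_bigr _ cardO) exchange_big /= /ncard card_fset_sum1.
rewrite big_seq [RHS]big_seq; apply: eq_bigr => x; rewrite in_fset_set // inE => /SO[j Qj Oj].
rewrite (bigD1 j) //= asboolT // big1 ?addn0 // => i /andP[Qi ij].
by rewrite asboolF // => Oi; rewrite (disj i j x) ?eqxx in ij.
Qed.

End Counting.

(** * Words in the simple reflections *)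

Section RootSystem.
Variables (R : realType) (V : vectType R) (dot : {dot V for idfun}).
Variables (Phi : {fset V}) (n : nat) (alpha omega : 'I_n -> V).
Hypothesis Phi_root : is_root_system dot Phi.
Hypothesis alpha_basis : is_root_basis Phi alpha.
Hypothesis omega_dual : forall i j, dot (omega i) (alpha j) = (i == j)%:R.

Local Notation refl := (refl dot).
Local Notation W := (refl_group dot).
Local Notation Weyl := (W [set a | a \in Phi]).

(** As [omega] is dual to [alpha], [dot x (omega i)] is the coefficient of [alpha i] in [x]; on
    roots [nonneg] therefore means positive. *)
Definition nonneg (x : V) := [forall i, 0 <= dot x (omega i)].
Definition dominant (x : V) := [forall i, 0 <= dot x (alpha i)].

(** * Coordinates in the simple roots and positivity *)

Lemma dot_alpha_omega i j : dot (alpha j) (omega i) = (i == j)%:R.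
Proof. by rewrite dotC omega_dual. Qed.

Lemma coord_expand x : x = \sum_i dot x (omega i) *: alpha i.
Proof.
have /coord_basis E : basis_of fullv [tuple alpha i | i < n] := rb_basis alpha_basis.
rewrite [in LHS](E x) ?memvf //; apply: eq_bigr => i _.
rewrite nth_mktuple; congr (_ *: _).
rewrite [in RHS](E x) ?memvf // dot_suml (bigD1 i) //= big1 ?addr0.
  by rewrite dotZl nth_mktuple dot_alpha_omega eqxx mulr1.
move=> j ji; rewrite dotZl nth_mktuple dot_alpha_omega.
by rewrite eq_sym (negbTE ji) mulr0.
Qed.

Lemma coord_inj x y : (forall i, dot x (omega i) = dot y (omega i)) -> x = y.
Proof.
by move=> xy; rewrite (coord_expand x) (coord_expand y); apply: eq_bigr => i _; rewrite xy.
Qed.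

Lemma dot_expand x y : dot x y = \sum_i dot x (omega i) * dot (alpha i) y.
Proof.
by rewrite {1}(coord_expand x) dot_suml; apply: eq_bigr => i _; rewrite dotZl.
Qed.

Lemma coord_sum_alpha (c : 'I_n -> R) i : dot (\sum_j c j *: alpha j) (omega i) = c i.
Proof.
rewrite dot_suml (bigD1 i) //= big1 ?addr0 ?dotZl ?dot_alpha_omega ?eqxx ?mulr1 // => j ji.
by rewrite dotZl dot_alpha_omega eq_sym (negbTE ji) mulr0.
Qed.

Lemma rootN a : a \in Phi -> - a \in Phi.
Proof. by move=> aP; rewrite -(refl_self dot) (rs_refl Phi_root). Qed.

Lemma root_neq0 a : a \in Phi -> a != 0.
Proof. by apply: contraTneq => ->; exact: rs_nonzero Phi_root. Qed.

Lemma alpha_root i : alpha i \in Phi.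
Proof. exact: rb_root alpha_basis i. Qed.

Lemma nonnegP x : reflect (forall i, 0 <= dot x (omega i)) (nonneg x).
Proof. exact: forallP. Qed.

Lemma dominantP x : reflect (forall i, 0 <= dot x (alpha i)) (dominant x).
Proof. exact: forallP. Qed.

Lemma alpha_nonneg i : nonneg (alpha i).
Proof. by apply/nonnegP => j; rewrite dot_alpha_omega ler0n. Qed.

Lemma root_sign b : b \in Phi -> nonneg b \/ nonneg (- b).
Proof.
move=> /(rb_sign alpha_basis) [k [bE kS]].
have coE i : dot b (omega i) = (k i)%:~R.
  rewrite bE -(coord_sum_alpha (fun i => (k i)%:~R)); congr (dot _ _).
  by apply: eq_bigr => j _; rewrite scaler_int.
case: kS => kS; [left|right]; apply/nonnegP => i.
  by rewrite coE ler0z.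
by rewrite dotNl coE oppr_ge0 lerz0.
Qed.

Lemma nonneg_antisym b : b \in Phi -> nonneg b -> nonneg (- b) -> False.
Proof.
move=> bP /nonnegP b0 /nonnegP b1; move: (root_neq0 bP).
rewrite (coord_expand b) big1 ?eqxx // => i _.
suff -> : dot b (omega i) = 0 by rewrite scale0r.
by apply/eqP; rewrite eq_le b0 andbT -oppr_ge0 -dotNl b1.
Qed.

Lemma coord_refl i j x : i != j -> dot (refl (alpha i) x) (omega j) = dot x (omega j).
Proof.
by move=> ij; rewrite dot_refll dot_alpha_omega eq_sym (negbTE ij) mulr0 subr0.
Qed.

Lemma coord_refl_self i x :
  dot (refl (alpha i) x) (omega i)
  = dot x (omega i) - 2 * dot x (alpha i) / dot (alpha i) (alpha i).
Proof. by rewrite dot_refll dot_alpha_omega eqxx mulr1. Qed.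

Lemma refl_root i b : b \in Phi -> refl (alpha i) b \in Phi.
Proof. by move=> bP; apply: (rs_refl Phi_root) => //; exact: alpha_root. Qed.

(** The reflection changes only the coordinate at [i]. Were the image negative, all other
    coordinates of [b] would vanish, and reducedness would force [b = alpha i]. *)
Lemma nonneg_refl i b : b \in Phi -> nonneg b -> b != alpha i ->
  nonneg (refl (alpha i) b).
Proof.
move=> bP b0 bi; have [//|] := root_sign (refl_root i bP) => /nonnegP sN.
have bE : b = dot b (omega i) *: alpha i.
  rewrite {1}(coord_expand b) (bigD1 i) //= big1 ?addr0 // => j ji.
  suff -> : dot b (omega j) = 0 by rewrite scale0r.
  apply/eqP; rewrite eq_le (nonnegP _ b0) andbT.
  by move: (sN j); rewrite dotNl coord_refl 1?eq_sym // oppr_ge0.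
have := rs_reduced Phi_root (alpha_root i) (c := dot b (omega i)).
rewrite -bE => /(_ bP) [c1|c1]; first by move: bi; rewrite bE c1 scale1r eqxx.
by move: (nonnegP _ b0 i); rewrite c1 ler0N1.
Qed.

(** The products sum to [dot x x]. This selects the simple reflection used in the height
    descents. *)
Lemma ex_coord_dot_gt0 x : x != 0 -> exists i, 0 < dot x (omega i) * dot x (alpha i).
Proof.
move=> /(dot_gt0 dot); rewrite {1}dot_expand => x0.
apply: contrapT => /forallNP xn; move: x0; rewrite ltNge => /negP; apply.
by apply: sumr_le0 => i _; rewrite leNgt (dotC _ _ x); apply/negP/xn.
Qed.

Lemma cartan_ge1 a b : a \in Phi -> b \in Phi -> 0 < dot b a ->
  1 <= 2 * dot b a / dot a a.
Proof.
move=> aP bP ba; have := rs_cryst Phi_root aP bP.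
have : 0 < 2 * dot b a / dot a a.
  by rewrite divr_gt0 ?mulr_gt0 // dot_gt0 // root_neq0.
by move=> + /intrP[z zE]; rewrite zE ltr0z ler1z gtz0_ge1.
Qed.

(** Pairing with the sum of the [omega j] is the height, the measure of the descents in [refl_word]
    and [support_rigid]. *)
Lemma dot_alpha_rho i : dot (alpha i) (\sum_j omega j) = 1.
Proof.
rewrite dot_sumr (bigD1 i) //= big1 ?addr0 ?dot_alpha_omega ?eqxx // => j ji.
by rewrite dot_alpha_omega (negbTE ji).
Qed.

Lemma height_refl i b : b \in Phi -> 0 < dot b (alpha i) ->
  dot (refl (alpha i) b) (\sum_j omega j) <= dot b (\sum_j omega j) - 1.
Proof.
move=> bP /(cartan_ge1 (alpha_root i) bP) k1.
by rewrite dot_refll dot_alpha_rho mulr1 lerD2l lerN2.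
Qed.

Lemma nat_gt (x : R) : exists N : nat, x < N%:R.
Proof.
by exists (Num.truncn `|x|).+1; rewrite (le_lt_trans (ler_norm x)) // truncnS_gt.
Qed.

Fixpoint word (l : seq 'I_n) : V -> V :=
  if l is i :: l' then refl (alpha i) \o word l' else idfun.

Lemma word_cat l l' : word (l ++ l') = word l \o word l'.
Proof. by elim: l => //= i l ->. Qed.

Lemma word_group (J : set 'I_n) l : (forall i, i \in l -> J i) ->
  W [set alpha i | i in J] (word l).
Proof.
elim: l => [|i l IH] lJ /=; first exact: refl_group1.
apply: refl_groupM; first by exists i => //; apply: lJ; rewrite mem_head.
by apply: IH => j jl; apply: lJ; rewrite in_cons jl orbT.
Qed.

Lemma simple_sub_roots (J : set 'I_n) : [set alpha i | i in J] `<=` [set a | a \in Phi].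
Proof. by move=> _ [i _ <-]; exact: alpha_root. Qed.

Lemma word_weyl l : Weyl (word l).
Proof. by apply: refl_group_sub (word_group (J := setT) _); first exact: simple_sub_roots. Qed.

Lemma weyl_root w b : Weyl w -> b \in Phi -> w b \in Phi.
Proof. by move=> Ww bP; elim: Ww => // a {}w aP _ IH; exact: (rs_refl Phi_root). Qed.

(** Descent on the height of a positive root: if [b] is not simple, some simple reflection makes it
    a positive root of smaller height, and the reflection in [b] is a conjugate of the reflection in
    that root. *)
Lemma refl_word b : b \in Phi -> exists l, refl b = word l.
Proof.
wlog b0 : b / nonneg b => [hw|] bP.
  have [b0|b0] := root_sign bP; first exact: hw.
  by rewrite -reflN; apply: hw => //; exact: rootN.
have [N bN] := nat_gt (dot b (\sum_j omega j)).
elim: N b b0 bP bN => [|N IH] b b0 bP bN.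
  move: bN; rewrite dot_sumr ltNge => /negP[].
  by apply: sumr_ge0 => i _; exact: (nonnegP _ b0).
have [i ib] := ex_coord_dot_gt0 (root_neq0 bP).
have bi0 : 0 < dot b (alpha i).
  rewrite ltNge; apply/negP => bi; move: ib; rewrite ltNge => /negP; apply.
  by rewrite mulr_ge0_le0 // (nonnegP _ b0).
have [->|bi] := eqVneq b (alpha i); first by exists [:: i].
have [|l lE] := IH _ (nonneg_refl bP b0 bi) (refl_root i bP).
  rewrite (le_lt_trans (height_refl bP bi0)) // ltrBlDr.
  by move: bN; rewrite -natr1.
exists (i :: l ++ [:: i]); apply/funext => x.
rewrite -{1}(reflK dot (alpha i) b) refl_conj lE /=.
by rewrite word_cat.
Qed.

Lemma weyl_word w : Weyl w -> exists l, w = word l.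
Proof.
elim=> [|a {}w /refl_word[l ->] _ [l' ->]]; first by exists [::].
by exists (l ++ l'); rewrite word_cat.
Qed.

(* The first reflection of the word, read from the right, that turns a positive
   root into a negative one turns it from the simple root [alpha i] and can be deleted. *)
Lemma exchange l j : nonneg (- word l (alpha j)) ->
  exists2 l', size l = (size l').+1 & word l \o refl (alpha j) = word l'.
Proof.
elim: l => [|i l IH] /= lj.
  by have := nonneg_antisym (alpha_root j) (alpha_nonneg j) lj.
have ljP := weyl_root (word_weyl l) (alpha_root j).
have [p|/IH[l' -> lE]] := root_sign ljP; last first.
  by exists (i :: l') => //=; rewrite -compA lE.
have [lji|lji] := eqVneq (word l (alpha j)) (alpha i); last first.
  have := nonneg_refl ljP p lji.
  by move=> /nonneg_antisym => /(_ (refl_root i ljP) lj).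
exists l => //; apply/funext => x /=; rewrite -lji.
have [w' [_ ww' w'w]] := refl_group_inv (word_weyl l).
have conj y : word l (refl (alpha j) y) = refl (word l (alpha j)) (word l y).
  have lW := word_weyl l.
  by rewrite /Defs.refl !(refl_group_isom lW) (refl_groupB lW) (refl_groupZ lW).
by rewrite conj reflK.
Qed.

(** Chevalley's theorem, by induction on the length of the word: its last letter either fixes [v] or
    is absorbed by [exchange]. *)
Lemma dominant_word_fix l v : dominant v -> dominant (word l v) ->
  word l v = v /\ W [set alpha i | i in [set i | dot v (alpha i) = 0]] (word l).
Proof.
move: {2}(size l) (leqnn (size l)) => N.
elim: N l => [|N IH] l; first by case: l => // _ _ _; split=> //; exact: refl_group1.
case/lastP: l => [|l j]; first by move=> *; split=> //; exact: refl_group1.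
rewrite size_rcons ltnS => lN vd lvd.
have wE : word (rcons l j) = word l \o refl (alpha j) by rewrite -cats1 word_cat.
have jP := alpha_root j.
have [p|p] := root_sign (weyl_root (word_weyl (rcons l j)) jP); last first.
  (* By isometry this is the product of the dominant [word (rcons l j) v] with a negative root,
     hence at most 0. *)
  have vj : dot v (alpha j) = 0.
    apply/eqP; rewrite eq_le (dominantP _ vd) andbT.
    rewrite -(refl_group_isom (word_weyl (rcons l j))) -oppr_ge0 -dotNr dotC dot_expand.
    apply: sumr_ge0 => i _; rewrite mulr_ge0 ?(nonnegP _ p) //.
    by rewrite dotC (dominantP _ lvd).
  move: lvd; rewrite wE /= refl_id // => lvd.
  have [-> lW] := IH l lN vd lvd; split=> //.
  by apply: (refl_group_comp lW); apply: refl_group_refl; exists j.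
(* Now [word l] sends [alpha j] to a negative root, so two letters of [rcons l j] disappear. *)
have [l' lE l'E] : exists2 l', size l = (size l').+1 & word l \o refl (alpha j) = word l'.
  by apply: exchange; rewrite wE /= refl_self in p *;
     rewrite (refl_groupN (word_weyl l)) in p.
rewrite wE l'E; move: lvd; rewrite wE l'E => lvd.
by apply: IH => //; rewrite (leq_trans _ lN) // lE ltnW.
Qed.

(** * Faces of the root polytope *)

(** Induction on the number of positive roots with negative product with [v]. If [alpha i] is one of
    them, reflecting [v] in it removes it from the set, and the reflection maps the new set
    injectively into the rest of the old one. *)
Lemma ex_dominant v : exists l, dominant (word l v).
Proof.
pose S v := [fset b in Phi | nonneg b && (dot v b < 0)]%fset.
have [N] := ubnP #|` S v|; elim: N v => // N IH v vN.
have [vd|] := boolP (dominant v); first by exists [::].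
rewrite /dominant negb_forall => /existsP[i]; rewrite -ltNge => vi.
have iS : alpha i \in S v by rewrite !inE alpha_root alpha_nonneg vi.
have [|l ld] := IH (refl (alpha i) v); last first.
  by exists (l ++ [:: i]); rewrite word_cat.
rewrite ltnS in vN; apply: leq_trans vN; rewrite [leqRHS](cardfsD1 (alpha i)) iS ltnS.
have inj : injective (refl (alpha i)) by exact: can_inj (reflK dot (alpha i)).
have <- : #|` [fset refl (alpha i) b | b in S (refl (alpha i) v)]%fset| = #|` S (refl (alpha i) v)|.
  by rewrite card_imfset.
apply: fsubset_leq_card.
apply/fsubsetP => _ /imfsetP[b /= + ->]; rewrite !inE => /andP[bP /andP[b0 bv]].
have bi : b != alpha i.
  apply: contraTneq bv => ->; rewrite refl_dotC refl_self dotNr -leNgt oppr_ge0.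
  exact: ltW.
rewrite refl_root // (nonneg_refl bP b0 bi) -refl_dotC bv !andbT.
apply: contraTneq b0 => bE; rewrite -(reflK dot (alpha i) b) bE refl_self.
by apply/negP => /(nonneg_antisym (alpha_root i) (alpha_nonneg i)).
Qed.

Lemma sum_weyl w (M : nmodType) (F : V -> M) : Weyl w ->
  \sum_(b <- Phi) F (w b) = \sum_(b <- Phi) F b.
Proof.
move=> Ww; have [w' [Ww' ww' w'w]] := refl_group_inv Ww.
rewrite -(big_map w predT F); apply: perm_big; apply: uniq_perm.
- by rewrite map_inj_uniq ?fset_uniq //; exact: can_inj ww'.
- exact: fset_uniq.
move=> b; apply/mapP/idP => [[a aP ->]|bP]; first exact: weyl_root.
by exists (w' b); rewrite ?w'w //; exact: weyl_root.
Qed.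

Local Notation P := (root_polytope Phi).

Lemma root_polytope_root a : a \in Phi -> P a.
Proof.
move=> aP; exists (fun b => (b == a)%:R); split=> [b _||]; first exact: ler0n.
  rewrite (big_fsetD1 a) //= eqxx big1_seq ?addr0 // => b /=.
  by rewrite !inE => /andP[/negbTE-> _].
rewrite (big_fsetD1 a) //= eqxx scale1r big1_seq ?addr0 // => b /=.
by rewrite !inE => /andP[/negbTE-> _]; rewrite scale0r.
Qed.

Lemma root_polytope_weyl w x : Weyl w -> P x -> P (w x).
Proof.
move=> Ww [c [c0 c1 ->]]; have [w' [Ww' ww' w'w]] := refl_group_inv Ww.
exists (c \o w'); split => [a aP||] /=; first by apply: c0; exact: weyl_root.
  by rewrite (sum_weyl c Ww').
rewrite (refl_group_sum Ww) -(sum_weyl (fun b => c (w' b) *: b) Ww).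
by apply: eq_bigr => b _; rewrite ww' (refl_groupZ Ww).
Qed.

(** The coefficients still range over [Phi] and merely vanish off [S], so that a representation of a
    point of the polytope can be reused unchanged. *)
Definition hull (S : {fset V}) : set V :=
  [set x | exists c : V -> R,
     [/\ forall a, a \in Phi -> 0 <= c a, \sum_(a <- Phi) c a = 1,
         x = \sum_(a <- Phi) c a *: a
       & forall a, a \in Phi -> c a != 0 -> a \in S]].

Definition face_roots (A : set V) : {fset V} := [fset b in Phi | `[< A b >]]%fset.

Lemma face_rootsP A b : reflect (b \in Phi /\ A b) (b \in face_roots A).
Proof. by rewrite !inE; apply: (iffP andP) => -[bP /asboolP bA]; split=> //; apply/asboolP. Qed.

(** In a convex combination on the supporting hyperplane the nonnegative defects
    [c a * (C - dot a v)] sum to 0, so every root of nonzero weight lies on the hyperplane. *)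
Lemma face_hull A : is_face dot P A -> A = hull (face_roots A).
Proof.
move=> [_ [v [C [vC ->]]]]; apply/seteqP; split=> x.
  move=> [[c [c0 c1 xE]] xv]; exists c; split=> // a aP ca.
  apply/face_rootsP; split=> //; split; first exact: root_polytope_root.
  have : \sum_(a <- Phi) c a * (C - dot a v) = 0.
    under eq_bigr do rewrite mulrBr.
    rewrite sumrB -mulr_suml c1 mul1r; apply/eqP; rewrite subr_eq0 -xv /= xE.
    by rewrite dot_suml; apply/eqP/eq_bigr => b _; rewrite dotZl.
  rewrite big_seq_cond => /eqP; rewrite psumr_eq0; last first.
    move=> b; rewrite andbT => bP; rewrite mulr_ge0 ?c0 // subr_ge0.
    by apply: vC; exact: root_polytope_root.
  by move=> /allP/(_ a aP); rewrite aP /= mulf_eq0 (negbTE ca) subr_eq0 => /eqP.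
move=> [c [c0 c1 xE cS]]; split; first by exists c.
rewrite /= xE dot_suml -[RHS]mul1r -c1 mulr_suml; apply: eq_big_seq => a aP.
rewrite dotZl; have [->|ca] := eqVneq (c a) 0; first by rewrite !mul0r.
by have /face_rootsP[_ [_ ->]] := cS a aP ca.
Qed.

Lemma face_eq A B : is_face dot P A -> is_face dot P B ->
  face_roots A = face_roots B -> A = B.
Proof. by move=> /face_hull {2}-> /face_hull {2}-> ->. Qed.

Lemma image_face v C w : Weyl w ->
  w @` (P `&` [set x | dot x v = C]) = P `&` [set x | dot x (w v) = C].
Proof.
move=> Ww; have [w' [Ww' ww' w'w]] := refl_group_inv Ww.
apply/seteqP; split=> [_ [x [xP /= <-] <-]|x [xP /= xC]].
  by split; [exact: root_polytope_weyl|rewrite /= (refl_group_isom Ww)].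
exists (w' x) => //; split; first exact: root_polytope_weyl.
by rewrite /= -(refl_group_isom Ww) w'w.
Qed.

Lemma is_face_weyl w A : Weyl w -> is_face dot P A -> is_face dot P (w @` A).
Proof.
move=> Ww [[x Ax] [v [C [vC AE]]]]; split; first by exists (w x), x.
exists (w v), C; split; last by rewrite AE; exact: image_face.
have [w' [Ww' ww' w'w]] := refl_group_inv Ww.
by move=> y yP; rewrite -[y]w'w (refl_group_isom Ww); apply: vC; exact: root_polytope_weyl.
Qed.

(** By [face_hull] every face is the hull of a subset of [Phi]. *)
Lemma finite_faces : finite_set [set A | is_face dot P A].
Proof.
apply: (@sub_finite_set _ _ (hull @` [set` fpowerset Phi])); last first.
  by apply: finite_image; exact: finite_fset.
move=> A /face_hull AE; exists (face_roots A) => //=.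
by rewrite fpowersetE; apply/fsubsetP => b /face_rootsP[].
Qed.

(** The unnormalised barycentre of the roots on [A]; for [A = F I] it is the vector [b_I]. *)
Definition bary (A : set V) : V := \sum_(b <- face_roots A) b.

Lemma face_roots_weyl w A : Weyl w ->
  face_roots (w @` A) = [fset w b | b in face_roots A]%fset.
Proof.
move=> Ww; have [w' [Ww' ww' w'w]] := refl_group_inv Ww.
apply/fsetP => b; apply/face_rootsP/imfsetP => [[bP [a Aa wa]]|[a /face_rootsP[aP Aa] ->]].
  exists a => //; apply/face_rootsP; split=> //.
  by rewrite -[a]ww' wa; exact: weyl_root.
by split; [exact: weyl_root|exists a].
Qed.

Lemma card_face_roots_weyl w A : Weyl w -> #|` face_roots (w @` A)| = #|` face_roots A|.
Proof.
move=> Ww; have [w' [_ ww' _]] := refl_group_inv Ww.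
by rewrite face_roots_weyl // card_imfset //; exact: can_inj ww'.
Qed.

Lemma bary_weyl w A : Weyl w -> bary (w @` A) = w (bary A).
Proof.
move=> Ww; have [w' [_ ww' _]] := refl_group_inv Ww.
rewrite /bary (refl_group_sum Ww) face_roots_weyl // big_imfset //=.
by move=> a b _ _; exact: can_inj ww' _ _.
Qed.

(** * Standard parabolic faces *)

Variables (theta : V) (m : 'I_n -> nat).
Hypothesis theta_highest : is_highest_root Phi alpha theta.
Hypothesis theta_coord : theta = \sum_(i < n) alpha i *+ m i.

Local Notation F := (std_face dot Phi omega m).
Implicit Types (I J : {set 'I_n}) (i j : 'I_n) (x b : V) (A B : set V).

Lemma theta_root : theta \in Phi.
Proof. by case: theta_highest. Qed.

Lemma coord_theta i : dot theta (omega i) = (m i)%:R.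
Proof.
rewrite theta_coord -(coord_sum_alpha (fun i => (m i)%:R)); congr (dot _ _).
by apply: eq_bigr => j _; rewrite scaler_nat.
Qed.

Lemma coord_root_le b i : b \in Phi -> dot b (omega i) <= (m i)%:R.
Proof.
case: theta_highest => _ /(_ b) + bP => /(_ bP) [k kE].
rewrite -coord_theta -subr_ge0 -dotBl kE.
rewrite (eq_bigr (fun i => (k i)%:R *: alpha i)) => [|j _]; last by rewrite scaler_nat.
by rewrite coord_sum_alpha ler0n.
Qed.

Lemma coord_root_ge b i : b \in Phi -> - (m i)%:R <= dot b (omega i).
Proof. by move=> bP; rewrite lerNl -dotNl coord_root_le // rootN. Qed.

Lemma mark_gt0 i : (0 < m i)%N.
Proof.
have := coord_root_le i (alpha_root i).
by rewrite dot_alpha_omega eqxx ler1n.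
Qed.

Lemma coord_polytope_le x i : P x -> dot x (omega i) <= (m i)%:R.
Proof.
move=> [c [c0 c1 ->]]; have -> : (m i)%:R = \sum_(a <- Phi) c a * (m i)%:R :> R.
  by rewrite -mulr_suml c1 mul1r.
rewrite dot_suml big_seq [leRHS]big_seq; apply: ler_sum => a aP.
by rewrite dotZl ler_wpM2l ?c0 ?coord_root_le.
Qed.

Lemma std_face_theta I : F I theta.
Proof.
by split=> [|i _]; [exact: root_polytope_root theta_root|exact: coord_theta].
Qed.

Lemma std_face_refl I i b : i \notin I -> b \in Phi -> F I b -> F I (refl (alpha i) b).
Proof.
move=> iI bP [_ bI]; split; first exact/root_polytope_root/refl_root.
by move=> j jI; rewrite coord_refl ?bI //; apply: contraNneq iI => ->.
Qed.

(** The gap between the values of [v] at [theta] and at [x] is a sum of nonnegative products. It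
    vanishes iff [x] reaches the maximal coordinate wherever [v] has positive product with the
    simple root. *)
Lemma dominant_functional v C : dominant v -> (forall x, P x -> dot x v <= C) ->
  (exists2 x, P x & dot x v = C) ->
  P `&` [set x | dot x v = C] = F [set i | 0 < dot v (alpha i)]%SET.
Proof.
move=> vd vC [y yP yC].
have gap x : dot theta v - dot x v =
    \sum_i ((m i)%:R - dot x (omega i)) * dot (alpha i) v.
  rewrite (dot_expand theta) (dot_expand x) -sumrB.
  by apply: eq_bigr => i _; rewrite coord_theta mulrBl.
have gap0 x : P x -> forall i, 0 <= ((m i)%:R - dot x (omega i)) * dot (alpha i) v.
  move=> xP i; rewrite mulr_ge0 // 1?dotC ?(dominantP _ vd) //.
  by rewrite subr_ge0 dotC coord_polytope_le.
(* [C] bounds the value at [theta], a point of the polytope, and is attained at [y], where the gap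
   to [theta] is nonnegative. *)
have CE : C = dot theta v.
  apply/eqP; rewrite eq_le vC ?andbT; last exact: root_polytope_root theta_root.
  by rewrite -yC -subr_ge0 gap; apply: sumr_ge0 => i _; exact: gap0.
apply/seteqP; split=> x.
  move=> [xP /= xC]; split=> // i; rewrite inE => vi.
  have /eqP : dot theta v - dot x v = 0 by rewrite xC CE subrr.
  rewrite gap psumr_eq0 => [/allP/(_ i (mem_index_enum _))/=|j _]; last exact: gap0.
  by rewrite mulf_eq0 (dotC _ _ v) (gt_eqF vi) orbF subr_eq0 => /eqP->.
move=> [xP xI]; split=> //=; rewrite CE; apply/eqP.
rewrite eq_sym -subr_eq0 gap big1 // => i _.
have [vi|] := boolP (0 < dot v (alpha i)); first by rewrite xI ?inE // subrr mul0r.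
rewrite -leNgt dotC => vi; suff -> : dot (alpha i) v = 0 by rewrite mulr0.
by apply/eqP; rewrite eq_le vi /= dotC (dominantP _ vd).
Qed.

Lemma std_face_is_face I : is_face dot P (F I).
Proof.
(* The product of this dominant vector with [alpha i] is the indicator of [i \in I], so
   [dominant_functional] gives back exactly [I]. *)
pose v : V := \sum_(i in I) omega i.
have vE i : dot v (alpha i) = (i \in I)%:R.
  rewrite /v dot_suml (eq_bigr (fun j => (j == i)%:R)); last by move=> j _; exact: omega_dual.
  have [iI|iI] := boolP (i \in I).
    by rewrite (bigD1 i) //= eqxx big1 ?addr0 // => j /andP[_ /negbTE->].
  by rewrite big1 // => j jI; case: eqVneq iI jI => // -> /negbTE->.
have vd : dominant v by apply/dominantP => i; rewrite vE ler0n.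
have vP x : P x -> dot x v <= dot theta v.
  move=> xP; rewrite (dot_expand x) (dot_expand theta); apply: ler_sum => i _.
  by rewrite coord_theta ler_wpM2r ?coord_polytope_le // dotC (dominantP _ vd).
have FE : P `&` [set x | dot x v = dot theta v] = F I.
  rewrite dominant_functional //; last by exists theta => //; exact: root_polytope_root theta_root.
  by congr (F _); apply/setP => i; rewrite inE vE ltr0n lt0b.
split; first by exists theta; exact: std_face_theta.
by exists v, (dot theta v); split.
Qed.

Lemma face_std_face A : is_face dot P A -> exists l I, word l @` A = F I.
Proof.
move=> [[x Ax] [v [C [vC AE]]]]; have [l ld] := ex_dominant v.
exists l, [set i | 0 < dot (word l v) (alpha i)]%SET.
have lW := word_weyl l; have [w' [Ww' ww' w'w]] := refl_group_inv lW.
rewrite AE image_face // dominant_functional //.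
  by move=> y yP; rewrite -[y]w'w (refl_group_isom lW); apply: vC; exact: root_polytope_weyl.
move: Ax; rewrite AE => -[xP /= xC]; exists (word l x).
  exact: root_polytope_weyl.
by rewrite (refl_group_isom lW).
Qed.

(** [b] already has the maximal coordinate at [i], and reflecting it in [alpha i] gives a root,
    whose coordinate cannot be larger. *)
Lemma dot_std_face_ge0 I i b : i \in I -> b \in Phi -> F I b -> 0 <= dot b (alpha i).
Proof.
move=> iI bP [_ /(_ i iI) bi]; have := coord_root_le i (refl_root i bP).
rewrite coord_refl_self bi gerDl oppr_le0.
by rewrite pmulr_lge0 ?invr_gt0 ?dot_gt0 ?root_neq0 ?alpha_root // pmulr_rge0.
Qed.

Lemma std_face_refl_image I i : i \notin I -> refl (alpha i) @` F I = F I.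
Proof.
move=> iI; have sW : Weyl (refl (alpha i)) by apply: refl_group_refl; exact: alpha_root.
have sub x : F I x -> F I (refl (alpha i) x).
  move=> [xP xI]; split; first exact: root_polytope_weyl.
  by move=> j jI; rewrite coord_refl ?xI //; apply: contraNneq iI => ->.
apply/seteqP; split=> [_ [x Fx <-]|x Fx]; first exact: sub.
by exists (refl (alpha i) x); [exact: sub|rewrite reflK].
Qed.

(** The reflection in [alpha i] preserves the face, hence fixes the sum of its roots. *)
Lemma dot_bary_notin I i : i \notin I -> dot (bary (F I)) (alpha i) = 0.
Proof.
move=> iI; have sW : Weyl (refl (alpha i)) by apply: refl_group_refl; exact: alpha_root.
have bE : refl (alpha i) (bary (F I)) = bary (F I) by rewrite -bary_weyl // std_face_refl_image.
have : dot (bary (F I)) (alpha i) = - dot (bary (F I)) (alpha i).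
  by rewrite -{1}bE refl_dotC refl_self dotNr.
lra.
Qed.

Lemma bary_dominant I : dominant (bary (F I)).
Proof.
apply/dominantP => i; have [iI|/dot_bary_notin->//] := boolP (i \in I).
rewrite /bary dot_suml big_seq sumr_ge0 // => b /face_rootsP[bP Fb].
exact: dot_std_face_ge0 iI bP Fb.
Qed.

(* On [F I] each [dot _ (omega i)], [i \in I], is at its maximum [m i] over the roots,
   so the sum over the roots of [B] forces it to be maximal on each of them. *)
Lemma face_eq_of_bary I B : is_face dot P B -> bary B = bary (F I) ->
  #|` face_roots B| = #|` face_roots (F I)| -> B = F I.
Proof.
move=> Bf BI cB; apply: face_eq => //; first exact: std_face_is_face.
apply/eqP; rewrite eqEfcard cB leqnn andbT; apply/fsubsetP => b bB.
have /face_rootsP[bP Bb] := bB; apply/face_rootsP; split=> //.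
split=> [|i iI]; first exact: root_polytope_root.
have : \sum_(a <- face_roots B) ((m i)%:R - dot a (omega i)) = 0.
  rewrite sumrB big_const_seq count_predT iter_addr_0 -dot_suml -/(bary B) BI.
  rewrite /bary dot_suml big_seq (eq_bigr (fun=> (m i)%:R)).
    by rewrite -big_seq big_const_seq count_predT iter_addr_0 cB subrr.
  by move=> a /face_rootsP[_ [_ ->]].
rewrite big_seq => /eqP; rewrite psumr_eq0; last first.
  by move=> a /face_rootsP[aP _]; rewrite subr_ge0 coord_root_le.
by move=> /allP/(_ b bB); rewrite bB /= subr_eq0 => /eqP->.
Qed.

(** The vectors [bary (F I)] and [bary (F J)] are dominant and in one orbit, hence equal; together
    with the number of roots this determines the face. *)
Lemma std_face_orbit I J w : Weyl w -> w @` F I = F J -> F I = F J.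
Proof.
move=> Ww wIJ; have [l lE] := weyl_word Ww.
have wb : w (bary (F I)) = bary (F J) by rewrite -bary_weyl // wIJ.
apply: face_eq_of_bary; first exact: std_face_is_face.
  have := dominant_word_fix (bary_dominant I) (l := l).
  by rewrite -lE wb => /(_ (bary_dominant J)) [].
by rewrite -wIJ card_face_roots_weyl.
Qed.

(** * The component of [alpha_0] *)

Local Notation comp0 := (comp0 dot alpha theta).
Local Notation aff_simple := (aff_simple alpha theta).
Local Notation border := (border dot alpha theta).

(** Induction along a path from [alpha_0]. A path may return to [None], but there [Q] is known, so
    only steps to some [alpha i] remain. *)
Lemma comp0_ind I (Q : option 'I_n -> Prop) : Q None ->
  (forall o i, comp0 I o -> Q o -> i \notin I ->
     dot (aff_simple o).1 (alpha i) != 0 -> Q (Some i)) ->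
  forall o, comp0 I o -> Q o.
Proof.
move=> Q0 QS o /connectP[p]; elim/last_ind: p o => [|p o' IH] o /=.
  by move=> _ ->.
rewrite rcons_path last_rcons => /andP[pp /and4P[_ + _]] e ->.
have C : comp0 I (last None p) by apply/connectP; exists p.
have := IH _ pp erefl; case: o' e => [i|] // e QL; rewrite !inE => iI.
by apply: QS C QL _ e; apply: contra iI => /(imset_f Some).
Qed.

(** Start from [theta] and walk through the component. A root on the face orthogonal to [alpha i]
    but not to the neighbour [alpha j] is reflected in [alpha j]: it stays on the face since
    [j \notin I], and is no longer orthogonal to [alpha i]. *)
Lemma comp0_ex_dot I o : comp0 I o -> forall i, dot (aff_simple o).1 (alpha i) != 0 ->
  exists b, [/\ b \in Phi, F I b & dot b (alpha i) != 0].
Proof.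
elim/comp0_ind: o / => [|o j _ IH jI oj] i.
  move=> /=; rewrite dotNl oppr_eq0 => ti.
  by exists theta; split=> //; [exact: theta_root|exact: std_face_theta].
move=> /= ji; have [b [bP bF bj]] := IH j oj.
have [bi|bi] := eqVneq (dot b (alpha i)) 0; last by exists b.
exists (refl (alpha j) b); split; [exact: refl_root|exact: std_face_refl|].
rewrite dot_refll bi sub0r oppr_eq0 !mulf_neq0 ?invr_eq0 ?pnatr_eq0 //.
by rewrite dot_eq0 root_neq0 ?alpha_root.
Qed.

Lemma comp0_Some I i : comp0 I (Some i) -> i \notin I /\
  exists b, [/\ b \in Phi, F I b & dot b (alpha i) != 0].
Proof.
(* [alpha i] is not orthogonal to itself, so [comp0_ex_dot] applies with [i] as its own
   neighbour. *)
move=> iC; split; last by apply: (comp0_ex_dot iC); rewrite /= dot_eq0 root_neq0 ?alpha_root.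
exact: (comp0_ind (Q := fun o => if o is Some j then j \notin I else true) _ _ iC).
Qed.

Lemma comp0_step I o i : comp0 I o -> i \notin I ->
  dot (aff_simple o).1 (alpha i) != 0 -> comp0 I (Some i).
Proof.
move=> oC iI oi; have [<-//|oSi] := eqVneq o (Some i).
apply: (connect_trans oC); apply: connect1.
rewrite /ext_dynkin oSi oi !inE !andbT; apply/andP; split.
  case: o oC {oi oSi} => [j|] oC; last by apply/imsetP => -[].
  by have [jI _] := comp0_Some oC; apply: contra jI => /imsetP[k kI [->]].
by apply: contra iI => /imsetP[j jI [->]].
Qed.

(* Reflecting a root [b <> a] in a suitable [alpha i], [i \in D], lowers its height and
   keeps its coordinates outside [D]; the descent ends at [a], which every such
   reflection fixes. *)
Lemma support_rigid (D : {set 'I_n}) a :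
  (forall i, i \in D -> dot a (alpha i) = 0) ->
  (forall b, b \in Phi -> (forall i, i \notin D -> dot b (omega i) = dot a (omega i)) ->
     forall i, i \in D -> dot a (omega i) <= dot b (omega i)) ->
  forall b, b \in Phi -> (forall i, i \notin D -> dot b (omega i) = dot a (omega i)) -> b = a.
Proof.
move=> aD ge_a b bP bD; pose rho := \sum_j omega j.
have [N bN] := nat_gt (dot (b - a) rho).
have sub_nonneg c : c \in Phi -> (forall i, i \notin D -> dot c (omega i) = dot a (omega i)) ->
    forall i, 0 <= dot (c - a) (omega i).
  move=> cP cD i; rewrite dotBl subr_ge0.
  by have [iD|iD] := boolP (i \in D); [exact: ge_a|rewrite cD].
elim: N b bP bD bN => [|N IH] b bP bD bN.
  move: bN; rewrite dot_sumr ltNge => /negP[].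
  by apply: sumr_ge0 => i _; exact: sub_nonneg.
apply/eqP; rewrite -subr_eq0; apply/negPn/negP => /ex_coord_dot_gt0[i ib].
have iD : i \in D.
  by apply: contraLR ib => iD; rewrite dotBl bD // subrr mul0r ltxx.
have bi : 0 < dot b (alpha i).
  have -> : dot b (alpha i) = dot (b - a) (alpha i) by rewrite dotBl aD ?subr0.
  rewrite ltNge; apply/negP => bi; move: ib; rewrite ltNge => /negP; apply.
  by rewrite mulr_ge0_le0 // sub_nonneg.
have sD j : j \notin D -> dot (refl (alpha i) b) (omega j) = dot a (omega j).
  by move=> jD; rewrite coord_refl ?bD //; apply: contraNneq jD => <-.
have sE : refl (alpha i) b = a.
  apply: IH => //; first exact: refl_root.
  have := height_refl bP bi; rewrite -/rho !dotBl => le.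
  by move: bN; rewrite -natr1 dotBl; lra.
have : dot (refl (alpha i) b) (alpha i) = 0 by rewrite sE aD.
rewrite refl_dotC refl_self dotNr; lra.
Qed.

(** [support_rigid] identifies [- b] with a vector [a] that takes the minimal coordinates [- m j]
    everywhere off the component. *)
Lemma coord_notin_comp0 I i b : b \in Phi -> F I b -> ~~ comp0 I (Some i) ->
  dot b (omega i) = (m i)%:R.
Proof.
move=> bP [_ bI] iC; have [/bI//|iI] := boolP (i \in I).
pose D := [set i | (i \notin I) && ~~ comp0 I (Some i)]%SET.
(* [a + theta] is supported on the component, so [a] is orthogonal to every [alpha j] with
   [j \in D], which is adjacent neither to [alpha_0] nor to the component. *)
pose a := - theta +
  \sum_j (if comp0 I (Some j) then (m j)%:R - dot b (omega j) else 0) *: alpha j.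
have aE j : dot a (omega j) =
    if comp0 I (Some j) then - dot b (omega j) else - (m j)%:R.
  rewrite dotDl dotNl coord_theta coord_sum_alpha.
  by case: ifP => _; rewrite ?addr0 // addKr.
suff ba : - b = a by move: (aE i); rewrite -ba dotNl (negbTE iC) => /oppr_inj.
apply: (@support_rigid D); rewrite ?rootN // => j.
- rewrite inE => /andP[jI jC]; have j0 o : comp0 I o -> dot (aff_simple o).1 (alpha j) = 0.
    by move=> oC; apply: contraNeq jC; exact: comp0_step.
  rewrite dotDl dot_suml (j0 None (connect0 _ _)) add0r big1 // => k _.
  by rewrite dotZl; case: ifP => [/j0/= ->|_]; rewrite ?mulr0 ?mul0r.
- move=> jP _ k; rewrite inE aE => /andP[_ /negbTE->]; exact: coord_root_ge.
rewrite inE negb_and negbK aE dotNl; case: ifP => // jC; rewrite orbF => jI.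
by rewrite bI.
Qed.

(* The largest [J] with [F J = F I]: see [std_face_closure] and [closure_setP]. *)
Definition closure_set I : {set 'I_n} := [set i | ~~ comp0 I (Some i)].

(** For [i] in the component some root on the face is not orthogonal to [alpha i]; its reflection
    stays on the face with another coordinate at [i], so the two are not both maximal. *)
Lemma closure_setP I i :
  reflect (forall b, b \in Phi -> F I b -> dot b (omega i) = (m i)%:R) (i \in closure_set I).
Proof.
rewrite inE; apply: (iffP idP) => [iC b bP bF|iF]; first exact: coord_notin_comp0 iC.
apply/negP => /comp0_Some[iI [b [bP bF]]]; apply/negP/negPn.
have := iF _ (refl_root i bP) (std_face_refl iI bP bF).
rewrite coord_refl_self (iF b bP bF) => /eqP; rewrite -subr_eq0 addrC addKr oppr_eq0.
by rewrite !mulf_eq0 invr_eq0 dot_eq0 (negbTE (root_neq0 (alpha_root i))) orbF pnatr_eq0.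
Qed.

Lemma sub_closure_set I : I \subset closure_set I.
Proof. by apply/fintype.subsetP => i iI; apply/closure_setP => b _ [_ ->]. Qed.

Lemma std_face_closure I : F (closure_set I) = F I.
Proof.
apply: face_eq; [exact: std_face_is_face|exact: std_face_is_face|].
apply/fsetP => b; apply/face_rootsP/face_rootsP => -[bP [bb bF]]; split=> //; split=> // i iI.
  by apply: bF; exact: (fintype.subsetP (sub_closure_set I)).
by move: iI => /closure_setP; apply.
Qed.

Lemma closure_set_eq I J : F I = F J -> closure_set I = closure_set J.
Proof. by move=> IJ; apply/setP => i; apply/closure_setP/closure_setP; rewrite IJ. Qed.

(** Connectedness of the extended diagram: an [alpha i] not reached from [alpha_0] would give
    [- theta], a root on [F] of the empty set, the coordinate [m i] instead of [- m i]. *)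
Lemma closure_set0 : closure_set finset.set0 = finset.set0.
Proof.
apply/setP => i; rewrite !inE; apply/negbTE/negP => i0.
have F0 : F finset.set0 (- theta).
  by split=> [|j]; [exact/root_polytope_root/rootN/theta_root|rewrite inE].
have := coord_notin_comp0 (rootN theta_root) F0 i0.
rewrite dotNl coord_theta; have : (0 : R) < (m i)%:R by rewrite ltr0n mark_gt0.
lra.
Qed.

(** For [i \in I] the roots on the face have nonnegative product with [alpha i], so the sum vanishes
    iff all products do. A border index has a nonzero one by [comp0_ex_dot]; otherwise [theta] and
    [theta - b], supported on the component, are orthogonal to [alpha i]. *)
Lemma dot_bary_eq0 I i : (dot (bary (F I)) (alpha i) == 0) = (i \notin border I).
Proof.
have [iI|iI] := boolP (i \in I); last first.
  by rewrite dot_bary_notin // inE (negbTE iI) eqxx.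
rewrite inE iI /=; apply/idP/existsPn => [/eqP b0 o|oF].
  apply/negP => /andP[oC /(comp0_ex_dot oC)[b [bP bF /negP]]]; apply; apply/eqP.
  move: b0; rewrite /bary dot_suml big_seq => /eqP; rewrite psumr_eq0.
    have bI : b \in face_roots (F I) by apply/face_rootsP.
    by move=> /allP/(_ b bI); rewrite bI /= => /eqP.
  by move=> c /face_rootsP[cP cF]; exact: dot_std_face_ge0 iI cP cF.
rewrite /bary dot_suml big_seq big1 // => b /face_rootsP[bP bF].
have j0 o : comp0 I o -> dot (aff_simple o).1 (alpha i) = 0.
  by move=> oC; have := oF o; rewrite oC /= negbK => /eqP.
have /eqP := j0 None (connect0 _ _); rewrite /= dotNl oppr_eq0 => /eqP ti.
suff : dot (theta - b) (alpha i) = 0 by rewrite dotBl ti sub0r => /eqP; rewrite oppr_eq0 => /eqP.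
rewrite dot_expand big1 // => j _; have [/j0/= ->|jC] := boolP (comp0 I (Some j)).
  by rewrite mulr0.
by rewrite dotBl coord_theta (coord_notin_comp0 bP bF jC) subrr mul0r.
Qed.

(** * Irreducible affine parabolic subsystems *)

Local Notation Psi I := (aff_parabolic Phi alpha theta (aff_compl I)).

Lemma aff_compl_None I : None \in aff_compl I.
Proof. by rewrite inE; apply/imsetP => -[]. Qed.

Lemma aff_compl_Some I i : (Some i \in aff_compl I) = (i \notin I).
Proof. by rewrite inE mem_imset // => ? ? []. Qed.

Lemma comp0_aff_compl I o : comp0 I o -> o \in aff_compl I.
Proof.
case: o => [i|_]; last exact: aff_compl_None.
by rewrite aff_compl_Some => /comp0_Some[].
Qed.

(** Only [alpha_0] has a [delta] part, so [x.2] is its coefficient in [x] and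
    [dot x.1 (omega i) + x.2 * (m i)%:R] that of [alpha i]; the span asks the latter to vanish on
    [I]. *)
Lemma aff_parabolicP I (x : V * R^o) : Psi I x <->
  [/\ x.1 \in Phi, x.2 \is a Num.int
    & forall i, i \in I -> dot x.1 (omega i) + x.2 * (m i)%:R = 0].
Proof.
split=> [[[xP xZ] /= xS]|[xP xZ xI]].
  split=> // i iI; move: xS; rewrite -[[seq _ | _ <- _]]/(val (in_tuple _)).
  move=> /coord_span ->; set c := coord _.
  set s := in_tuple _ in c *; pose f (x : V * R^o) : R := dot x.1 (omega i) + x.2 * (m i)%:R.
  have fD (x1 x2 : V * R^o) : f (x1 + x2) = f x1 + f x2 by rewrite /f /= dotDl mulrDl addrACA.
  have fZ k (x1 : V * R^o) : f (k *: x1) = k * f x1.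
    by rewrite /f /= dotZl mulrDr mulrA.
  rewrite -/(f _); elim/big_rec: _ => [|j y _ IH]; first by rewrite /f dot0l mul0r addr0.
  rewrite fD IH addr0 fZ; suff -> : f s`_j = 0 by rewrite mulr0.
  have : s`_j \in (s : seq _) by apply: mem_nth; exact: ltn_ord j.
  move=> /mapP[o]; rewrite mem_enum => oG ->; rewrite /f.
  case: o oG => [k|_] /=; last by rewrite dotNl coord_theta mul1r addNr.
  rewrite aff_compl_Some dot_alpha_omega mul0r addr0.
  by case: eqVneq => // <-; rewrite iI.
split; first by split.
rewrite /=; suff -> : x = x.2 *: aff_simple None +
    \sum_(i | i \notin I) (dot x.1 (omega i) + x.2 * (m i)%:R) *: aff_simple (Some i).
  apply: memvD; first by rewrite memvZ // memv_span // map_f // mem_enum aff_compl_None.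
  apply: memv_suml => i iI; rewrite memvZ // memv_span //.
  by apply: map_f; rewrite mem_enum aff_compl_Some.
rewrite [LHS]surjective_pairing [RHS]surjective_pairing /=; congr pair; last first.
  rewrite (big_morph snd (fun _ _ => erefl) erefl) big1 ?addr0 => [|i _].
    by rewrite [RHS]mulr1.
  exact: mulr0.
rewrite (big_morph fst (fun _ _ => erefl) erefl) big_mkcond /=.
apply: coord_inj => j; rewrite dotDl dotZl dotNl coord_theta.
rewrite (eq_bigr (fun i => (if i \notin I then dot x.1 (omega i) + x.2 * (m i)%:R else 0)
  *: alpha i)) => [|i _]; last by case: ifP; rewrite ?scale0r.
rewrite coord_sum_alpha; case: ifPn => [_|/negPn/xI]; first by rewrite mulrN addrCA addNr addr0.
by move=> e; rewrite addr0 mulrN; apply/eqP; rewrite -addr_eq0 e.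
Qed.

(* [x = x.2 alpha_0 + sum_i (x.1 + x.2 theta)_i alpha_i], paired with [y]. *)
Lemma aff_dot_expand (x y : V * R^o) : aff_dot dot x y =
  x.2 * dot (- theta) y.1
  + \sum_i (dot x.1 (omega i) + x.2 * (m i)%:R) * dot (alpha i) y.1.
Proof.
rewrite /aff_dot (dot_expand x.1) dotNl mulrN (dot_expand theta) addrC.
rewrite -mulrN -sumrN mulr_sumr -big_split; apply: eq_bigr => i _ /=.
rewrite coord_theta; ring.
Qed.

(** In an orthogonal splitting, the part containing [alpha_0] absorbs its neighbours and so the
    whole component. An element of the other part is a combination of these simple roots, hence
    orthogonal to itself, although its finite part is a root. *)
Lemma connected_irreducible I : closure_set I = I ->
  irreducible_roots (aff_dot dot) (Psi I).
Proof.
move=> cI; have simple_Psi o : comp0 I o -> Psi I (aff_simple o).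
  move=> /comp0_aff_compl oG; apply/aff_parabolicP; case: o oG => [j|_] /=.
    rewrite aff_compl_Some => jI; split; rewrite ?alpha_root ?int_num0 // => i iI.
    by rewrite dot_alpha_omega mul0r addr0; case: eqVneq jI => // <-; rewrite iI.
  split; rewrite ?rootN ?theta_root ?int_num1 // => i iI.
  by rewrite dotNl coord_theta mul1r addNr.
split; first by exists (aff_simple None); apply: simple_Psi; exact: connect0.
have main (A B : set (V * R^o)) : A (aff_simple None) -> A `|` B = Psi I ->
    (forall a b : V * R^o, A a -> B b -> aff_dot dot a b = 0) -> forall b : V * R^o, ~ B b.
  move=> A0 AB orth b Bb.
  have Asimple o : comp0 I o -> A (aff_simple o).
    elim/comp0_ind: o / => // o i oC Ao iI oi.
    have : Psi I (aff_simple (Some i)) by apply: simple_Psi; exact: comp0_step oC iI oi.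
    by rewrite -AB => -[//|/(orth _ _ Ao)]; move/eqP: oi.
  have /aff_parabolicP[bP _ bI] : Psi I b by rewrite -AB; right.
  have t0 : dot (- theta) b.1 = 0 := orth _ _ A0 Bb.
  have /eqP := aff_dot_expand b b; rewrite /aff_dot t0 mulr0 add0r.
  rewrite big1 ?dot_eq0 ?(negbTE (root_neq0 bP)) // => i _.
  have [iI|iI] := boolP (i \in I); first by rewrite bI // mul0r.
  have iC : comp0 I (Some i) by move: iI; rewrite -{1}cI inE negbK.
  by have := orth _ _ (Asimple _ iC) Bb; rewrite /aff_dot /= => ->; rewrite mulr0.
move=> [A [B [[a Aa] [b Bb] AB orth]]].
have : Psi I (aff_simple None) by apply: simple_Psi; exact: connect0.
rewrite -AB => -[A0|B0]; first exact: main A0 AB orth b Bb.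
apply: (main B A B0 _ _ a Aa); first by rewrite setUC.
by move=> x y Bx Ay; rewrite /aff_dot dotC; exact: orth.
Qed.

(** By contraposition: an [alpha i] outside both [I] and the component splits the subsystem into the
    roots [A] supported on the component of [alpha_0] and the roots [B] supported off it. *)
Lemma irreducible_connected I : irreducible_roots (aff_dot dot) (Psi I) ->
  closure_set I = I.
Proof.
move=> [_ nosplit]; apply/eqP; rewrite finset.eqEsubset sub_closure_set andbT.
apply/negPn/negP => /fintype.subsetPn[i]; rewrite inE => iC iI; apply: nosplit.
pose A := Psi I `&` [set x | forall j, j \notin I -> ~~ comp0 I (Some j) ->
  dot x.1 (omega j) + x.2 * (m j)%:R = 0].
pose B := Psi I `&` [set x | x.2 = 0 /\ forall j, comp0 I (Some j) -> dot x.1 (omega j) = 0].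
exists A, B; split.
- exists (aff_simple None); split=> [|j _ _] /=; last by rewrite dotNl coord_theta mul1r addNr.
  apply/aff_parabolicP; split; rewrite /= ?rootN ?theta_root ?int_num1 // => j jI.
  by rewrite dotNl coord_theta mul1r addNr.
- exists (aff_simple (Some i)); split=> [|/=]; last first.
    split=> // j jC; rewrite dot_alpha_omega.
    by case: eqVneq jC => // ->; rewrite (negbTE iC).
  apply/aff_parabolicP; split; rewrite /= ?alpha_root ?int_num0 // => j jI.
  by rewrite dot_alpha_omega mul0r addr0; case: eqVneq jI => // ->; rewrite (negbTE iI).
- apply/seteqP; split=> [x [[]//|[]//]|x xPsi].
  have /aff_parabolicP[xP xZ xI] := xPsi.
  (* [I] is nonempty by [closure_set0]; the equation at [k0] bounds [x.2] by 1 in absolute value, so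
     only three levels occur. *)
  have [k0 k0I] : exists k0, k0 \in I.
    apply/finset.set0Pn; apply: contraNneq iC => I0; move: closure_set0.
    by rewrite -I0 => cI; move: iI; rewrite -{1}cI inE negbK.
  have : [|| x.2 == 0, x.2 == 1 | x.2 == - 1].
    have m0 : (0 : R) < (m k0)%:R by rewrite ltr0n mark_gt0.
    have le1 : x.2 <= 1.
      have := coord_root_ge k0 xP; have := xI k0 k0I; nra.
    have ge1 : - 1 <= x.2.
      have := coord_root_le k0 xP; have := xI k0 k0I; nra.
    move: le1 ge1; case/intrP: xZ => z ->.
    rewrite lerz1 -(intrN R 1) ler_int => z1 z2.
    have : [|| z == 0, z == 1 | z == - 1] by case: z z1 z2 => [[|[|?]]|[|?]].
    by case/or3P => /eqP->; rewrite eqxx ?orbT.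
  case/or3P => /eqP x2.
  (* Level 0: a root with a nonzero coordinate on the component must vanish off it. Up to sign it is
     positive, and [support_rigid] compares it with its own part [a] on the component. *)
  + have [x0|] := pselect (forall j, comp0 I (Some j) -> dot x.1 (omega j) = 0).
      by right; split.
    move=> /existsNP[j0 /not_implyP[j0C /eqP j0N]]; left; split=> // j jI jC.
    rewrite x2 mul0r addr0.
    have main c : c \in Phi -> (forall i, i \in I -> dot c (omega i) = 0) ->
        dot c (omega j0) != 0 -> nonneg c -> dot c (omega j) = 0.
      move=> cP cI cj0 c0; pose D := [set i | (i \notin I) && ~~ comp0 I (Some i)]%SET.
      pose a := \sum_i (if comp0 I (Some i) then dot c (omega i) else 0) *: alpha i.
      have aE i0 : dot a (omega i0) = if comp0 I (Some i0) then dot c (omega i0) else 0.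
        by rewrite coord_sum_alpha.
      suff -> : c = a by rewrite aE (negbTE jC).
      apply: (@support_rigid D) => // [i0|c' c'P c'D i0|i0].
      - rewrite inE => /andP[i0I i0C]; rewrite /a dot_suml big1 // => k _.
        rewrite dotZl; case: ifP => [kC|_]; last by rewrite mul0r.
        suff -> : dot (alpha k) (alpha i0) = 0 by rewrite mulr0.
        by apply: contraNeq i0C; exact: (comp0_step kC).
      (* [c'] has a positive coordinate at [j0], hence is positive. *)
      - rewrite inE aE => /andP[_ /negbTE->]; have [/nonnegP//|/nonnegP/(_ j0)] := root_sign c'P.
        rewrite dotNl c'D ?inE ?j0C ?andbF // aE j0C oppr_ge0 le_eqVlt (negbTE cj0) /=.
        by rewrite ltNge (nonnegP _ c0).
      rewrite inE negb_and !negbK aE; case: ifP => // _; rewrite orbF; exact: cI.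
    have xI0 i0 : i0 \in I -> dot x.1 (omega i0) = 0.
      by move=> /xI; rewrite x2 mul0r addr0.
    have [x0|x0] := root_sign xP; first exact: main.
    apply/eqP; rewrite -oppr_eq0 -dotNl; apply/eqP/main; rewrite ?rootN ?dotNl ?oppr_eq0 //.
    by move=> i0 /xI0; rewrite dotNl => ->; rewrite oppr0.
  (* At levels 1 and -1, respectively [- x.1] and [x.1] lie on [F I], and [coord_notin_comp0] gives
     the coordinates off the component. *)
  + left; split=> // j jI jC; have xF : F I (- x.1).
      split=> [|k kI]; first exact/root_polytope_root/rootN.
      by rewrite dotNl; have := xI k kI; rewrite x2; lra.
    by have := coord_notin_comp0 (rootN xP) xF jC; rewrite dotNl x2; lra.
  + left; split=> // j jI jC; have xF : F I x.1.
      split=> [|k kI]; first exact/root_polytope_root.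
      by have := xI k kI; rewrite x2; lra.
    by have := coord_notin_comp0 xP xF jC; rewrite x2; lra.
move=> x y [/aff_parabolicP[_ _ xI] xA] [/aff_parabolicP[_ _ yI] [y2 yC]].
have j0 o : comp0 I o -> dot (aff_simple o).1 y.1 = 0.
  move=> oC; rewrite dotC dot_expand big1 // => j _.
  have [/yC->|jC] := boolP (comp0 I (Some j)); first by rewrite mul0r.
  have [/yI|jI] := boolP (j \in I); first by rewrite y2 mul0r addr0 => ->; rewrite mul0r.
  suff : dot (aff_simple o).1 (alpha j) = 0 by rewrite dotC => ->; rewrite mulr0.
  by apply: contraNeq jC; exact: comp0_step oC jI.
rewrite aff_dot_expand (j0 None (connect0 _ _)) mulr0 add0r big1 // => j _.
have [/j0/= ->|jC] := boolP (comp0 I (Some j)); first by rewrite mulr0.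
have [/xI->|jI] := boolP (j \in I); first by rewrite mul0r.
by rewrite xA // mul0r.
Qed.

(** * Counting faces *)

Lemma alpha_span_dim I : \dim <<[seq alpha i | i <- enum (~: I)]>>%VS = (n - #|I|)%N.
Proof.
have nE : (#|I| + #|~: I|)%N = n by rewrite cardsC card_ord.
have fr : free [seq alpha i | i <- enum 'I_n].
  by have /andP[_] := rb_basis alpha_basis.
have pe : perm_eq (enum 'I_n) (enum (~: I)%SET ++ enum I).
  apply: uniq_perm; rewrite ?enum_uniq // ?cat_uniq ?enum_uniq ?andbT /=.
    by apply/hasPn => i; rewrite !mem_enum inE negbK.
  by move=> i; rewrite mem_cat !mem_enum !inE orNb.
have := perm_free (perm_map alpha pe); rewrite fr map_cat => /esym/catl_free.
by rewrite /free => /eqP->; rewrite size_map -cardE -[X in (X - _)%N]nE addKn.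
Qed.

(** For [i \notin I] the component contains [alpha i], so some root [b] on the face is moved along
    the face by the reflection in [alpha i]; the difference is a nonzero multiple of [alpha i]. *)
Lemma std_face_dim I : closure_set I = I -> has_aff_dim (F I) (n - #|I|).
Proof.
move=> cI; split; first by exists theta; exact: std_face_theta.
exists <<[seq alpha i | i <- enum (~: I)%SET]>>%VS; split.
- exact: alpha_span_dim.
- move=> x y [_ xI] [_ yI]; rewrite (coord_expand (x - y)); apply: memv_suml => i _.
  have [iI|iI] := boolP (i \in I); first by rewrite dotBl xI // yI // subrr scale0r mem0v.
  by rewrite memvZ // memv_span // map_f // mem_enum inE.
move=> U UF; apply/span_subvP => _ /mapP[i + ->]; rewrite mem_enum inE => iI.
have iC : comp0 I (Some i) by move: iI; rewrite -{1}cI inE negbK.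
have [_ [b [bP bF bi]]] := comp0_Some iC.
have := UF _ _ bF (std_face_refl iI bP bF); rewrite /Defs.refl opprB addrCA subrr addr0.
set k := 2 * _ / _ => /(memvZ k^-1); rewrite scalerA mulVf ?scale1r //.
by rewrite /k !mulf_neq0 ?invr_eq0 ?pnatr_eq0 // dot_eq0 root_neq0 ?alpha_root.
Qed.

(** * Stabilizers, orbits and the f-polynomial *)

Local Notation WB I := (W [set alpha i | i in [set i | i \notin border I]]).

Lemma border_stabE I :
  [set i | dot (bary (F I)) (alpha i) = 0] = [set i | i \notin border I].
Proof.
by apply/seteqP; split=> i /=; rewrite -dot_bary_eq0 => /eqP.
Qed.

(** The face and its [bary] have the same stabilizer; for a dominant vector it is generated by the
    simple reflections fixing it. *)
Lemma stab_std_face I h : Weyl h -> h @` F I = F I <-> WB I h.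
Proof.
move=> Wh; rewrite -border_stabE; split=> [hF|hB].
  have hb : h (bary (F I)) = bary (F I) by rewrite -bary_weyl // hF.
  have [l lE] := weyl_word Wh; rewrite lE.
  apply: (proj2 (dominant_word_fix (bary_dominant I) _)).
  by rewrite -lE hb; exact: bary_dominant.
have hb : h (bary (F I)) = bary (F I).
  by elim: hB => [|_ w [i /= bi <-] _ IH] //=; rewrite IH refl_id.
apply: face_eq_of_bary; first exact/is_face_weyl/std_face_is_face.
  by rewrite bary_weyl.
by rewrite card_face_roots_weyl.
Qed.

Lemma finite_orbit I : finite_set [set w @` F I | w in Weyl].
Proof.
apply: sub_finite_set finite_faces => _ [w Ww <-].
exact/is_face_weyl/std_face_is_face.
Qed.

(** Orbit and stabilizer: two elements move [F I] to the same face iff they define the same left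
    coset. *)
Lemma ncard_orbit I :
  ncard [set w @` F I | w in Weyl] = group_index Weyl (WB I).
Proof.
apply: ncard_image_eq; first exact: finite_orbit.
have WBsub h : WB I h -> Weyl h by apply: refl_group_sub; exact: simple_sub_roots.
move=> w1 w2 W1 W2; split=> [E|E].
  have sub u1 u2 : Weyl u1 -> Weyl u2 -> u1 @` F I = u2 @` F I ->
      [set u1 \o h | h in WB I] `<=` [set u2 \o h | h in WB I].
    move=> Wu1 Wu2 uE _ [h hB <-]; have [v [Wv uv vu]] := refl_group_inv Wu2.
    have vB : WB I (v \o u1).
      apply/stab_std_face; first exact: refl_group_comp.
      rewrite -image_comp uE image_comp; apply/seteqP; split=> x.
        by move=> [y Fy <-] /=; rewrite uv.
      by move=> Fx; exists x => //=; rewrite uv.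
    exists ((v \o u1) \o h); first exact: refl_group_comp.
    by apply/funext => x /=; rewrite vu.
  by apply/seteqP; split; exact: sub.
have : [set w1 \o h | h in WB I] w1 by exists idfun => //; exact: refl_group1.
rewrite E => -[h hB <-]; rewrite -image_comp; congr (_ @` _).
by apply/stab_std_face; first exact: WBsub.
Qed.

(** Each orbit of faces contains [F I] for exactly one [I] equal to its closure, and that [I]
    determines the dimension. *)
Lemma face_number_sum k : face_number dot P k =
  (\sum_(I : {set 'I_n} | (closure_set I == I) && (n - #|I| == k)) group_index Weyl (WB I))%N.
Proof.
under eq_bigr do rewrite -ncard_orbit.
apply: ncard_partition.
- by apply: sub_finite_set finite_faces => A [].
- move=> A; split=> [[fA dA]|[I /andP[/eqP cI /eqP Ik] [w Ww <-]]]; last first.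
    split; first exact/is_face_weyl/std_face_is_face.
    by rewrite -Ik; apply: has_aff_dim_weyl Ww _; exact: std_face_dim.
  have [l [J lA]] := face_std_face fA; pose I := closure_set J.
  have cI : closure_set I = I by apply: closure_set_eq; exact: std_face_closure.
  have lAI : word l @` A = F I by rewrite lA std_face_closure.
  have lW := word_weyl l; exists I; last first.
    have [w [Ww lw wl]] := refl_group_inv lW; exists w => //.
    by rewrite -lAI image_comp; under eq_imagel do rewrite /= lw; rewrite image_id.
  rewrite cI eqxx /=; apply/eqP; apply: (has_aff_dim_inj (A := F I)).
    exact: std_face_dim.
  by rewrite -lAI; apply: has_aff_dim_weyl lW _.
move=> I J A /andP[/eqP cI _] /andP[/eqP cJ _] [w Ww wA] [u Wu uA].
have [v [Wv uv vu]] := refl_group_inv Wu.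
rewrite -cI -cJ; apply: closure_set_eq; apply: (std_face_orbit (w := v \o w)).
  exact: refl_group_comp.
by rewrite -image_comp wA -uA image_comp; under eq_imagel do rewrite /= uv; rewrite image_id.
Qed.

Lemma face_polynomial :
  \sum_(k < n.+1) (face_number dot P k)%:R *: 'X^k =
  \sum_(I : {set 'I_n} | `[< irreducible_roots (aff_dot dot) (Psi I) >])
    (group_index Weyl (WB I))%:R *: 'X^(n - #|I|) :> {poly int}.
Proof.
rewrite [RHS](eq_bigl (fun I => closure_set I == I)); last first.
  move=> I; apply/asboolP/eqP; first exact: irreducible_connected.
  exact: connected_irreducible.
(* Index sets are grouped by dimension; [inord] loses nothing as [n - #|I|] is at most [n]. *)
rewrite [RHS](partition_big (fun I : {set 'I_n} => inord (n - #|I|) : 'I_n.+1) predT) //=.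
apply: eq_bigr => k _; rewrite face_number_sum natr_sum scaler_suml.
have dimE (I : {set 'I_n}) : (inord (n - #|I|) == k :> 'I_n.+1) = (n - #|I| == k)%N.
  by rewrite -val_eqE /= inordK // ltnS leq_subr.
by apply: eq_big => I; [rewrite dimE|move=> /andP[_ /eqP ->]].
Qed.

End RootSystem.

Theorem mainTheorem3 (R : realType) (V : vectType R) (dot : {dot V for idfun})
    (Phi : {fset V}) (n : nat) (alpha omega : 'I_n -> V)
    (theta : V) (m : 'I_n -> nat)
    (Phi_root : is_root_system dot Phi)
    (Phi_irr : irreducible_roots dot [set a | a \in Phi])
    (alpha_basis : is_root_basis Phi alpha)
    (theta_highest : is_highest_root Phi alpha theta)
    (theta_coord : theta = \sum_(i < n) alpha i *+ m i)
    (omega_dual : forall i j, dot (omega i) (alpha j) = (i == j)%:R) :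
  let P := root_polytope Phi in
  let F := std_face dot Phi omega m in
  let W := refl_group dot in
  let Weyl := W [set a | a \in Phi] in
  [/\ forall I : {set 'I_n}, is_face dot P (F I),
      forall A : set V, is_face dot P A ->
        exists (w : V -> V) (I : {set 'I_n}), Weyl w /\ w @` A = F I,
      forall (I J : {set 'I_n}) (w : V -> V),
        Weyl w -> w @` F I = F J -> F I = F J
    & \sum_(k < n.+1) (face_number dot P k)%:R *: 'X^k =
      \sum_(I : {set 'I_n} |
            `[< irreducible_roots (aff_dot dot)
                  (aff_parabolic Phi alpha theta (aff_compl I)) >])
        (group_index Weyl
           (W [set alpha i | i in [set i | i \notin border dot alpha theta I]]))%:R
          *: 'X^(n - #|I|) :> {poly int}].
Proof.
move=> P F W Weyl; split.
- by move=> I; apply: std_face_is_face; eassumption.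
- move=> A fA; have [l [I lI]] :=
    face_std_face Phi_root alpha_basis omega_dual theta_highest theta_coord fA.
  exists (word dot alpha l), I; split=> //; apply: word_weyl; eassumption.
- by move=> I J w; apply: std_face_orbit; eassumption.
by apply: face_polynomial; eassumption.
Qed.
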